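(* Let $m=2h$, let $\mathcal{A}\in\mathbb{R}^{m\times p\times n}$ be $\star_{\mathbf{M}}$-symmetric, and put $\mathcal{X}_0=\mathcal{A}_{1:h,:,:}$, $\mathcal{X}_1=\mathcal{A}_{h+1:m,:,:}$. Let $$\mathcal{B}=\tfrac12\bigl(\mathcal{X}_0+\mathcal{R}\star_{\mathbf{M}}\mathcal{X}_1\bigr)\in\mathbb{R}^{h\times p\times n}$$ have (economy) $\star_{\mathbf{M}}$-SVD $\mathcal{B}=\mathcal{U}_0\star_{\mathbf{M}}\mathcal{S}_0\star_{\mathbf{M}}\mathcal{V}_0^{\mathsf T}$ with $\mathcal{U}_0\in\mathbb{R}^{h\times r\times n}$, $\mathcal{S}_0\in\mathbb{R}^{r\times r\times n}$, $\mathcal{V}_0\in\mathbb{R}^{p\times r\times n}$ (so $r\le h$). Define $$\mathcal{U}=\tfrac{1}{\sqrt2}\begin{bmatrix}\mathcal{U}_0\\ \mathcal{R}\star_{\mathbf{M}}\mathcal{U}_0\end{bmatrix}\in\mathbb{R}^{m\times r\times n},\qquad \mathcal{S}=\sqrt2\,\mathcal{S}_0,\qquad \mathcal{V}=\mathcal{V}_0,$$ where the two blocks are stacked along the first mode. Then: (i) $\mathcal{A}=\mathcal{U}\star_{\mathbf{M}}\mathcal{S}\star_{\mathbf{M}}\mathcal{V}^{\mathsf T}$, and this is an economy $\star_{\mathbf{M}}$-SVD of $\mathcal{A}$; in particular $\mathcal{U}^{\mathsf T}\star_{\mathbf{M}}\mathcal{U}$ is the $r\times r\times n$ identity tensor.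 (ii) $\mathcal{U}$ is itself $\star_{\mathbf{M}}$-symmetric: $\mathcal{U}_{h+1:m,:,:}=\mathcal{R}\star_{\mathbf{M}}\mathcal{U}_{1:h,:,:}$ (consequently $\mathcal{U}$ is determined by $\mathcal{U}_0$, so that only $\mathcal{U}_0$ need be stored for it). (iii) The singular tubes $\mathbf{s}_j=\mathcal{S}_{j,j,:}$ and $(\mathbf{s}_0)_j=(\mathcal{S}_0)_{j,j,:}$ satisfy $\|\mathbf{s}_j\|_F^2=2\|(\mathbf{s}_0)_j\|_F^2$ for all $j$, and $\|\mathbf{s}_1\|_F\ge\|\mathbf{s}_2\|_F\ge\cdots\ge\|\mathbf{s}_r\|_F$.
   Context: Standing assumption: $\mathbf{M}=cW$ is a real $n\times n$ matrix with $W$ orthogonal and $c\neq 0$. Third-order tensors are real arrays $\mathcal{A}\in\mathbb{R}^{m\times p\times n}$; $\|\mathcal{A}\|_F^2=\sum_{i,j,k}\mathcal{A}_{i,j,k}^2$. Sub-arrays use MATLAB notation. The mode-3 product $\mathcal{A}\times_3\mathbf{M}$ applies $\mathbf{M}$ to every tube $\mathcal{A}_{i,j,:}\in\mathbb{R}^n$. The transform of $\mathcal{A}$ is $\widehat{\mathcal{A}}=\mathcal{A}\times_3\mathbf{M}$, with transform-domain frontal slices (faces) $\hat A^{(i)}=\widehat{\mathcal{A}}_{:,:,i}\in\mathbb{R}^{m\times p}$, $i=1,\dots,n$. $\star_{\mathbf{M}}$-product: for $\mathcal{A}\in\mathbb{R}^{m\times p\times n}$, $\mathcal{B}\in\mathbb{R}^{p\times\ell\times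 n}$, $\mathcal{C}=\mathcal{A}\star_{\mathbf{M}}\mathcal{B}\in\mathbb{R}^{m\times\ell\times n}$ is the tensor with $\hat C^{(i)}=\hat A^{(i)}\hat B^{(i)}$ for all $i$. The transpose $\mathcal{A}^{\mathsf T}\in\mathbb{R}^{p\times m\times n}$ has faces $(\hat A^{(i)})^{\mathsf T}$. The $r\times r\times n$ identity tensor has every transform-domain face equal to the $r\times r$ identity matrix. Economy $\star_{\mathbf{M}}$-SVD of $\mathcal{A}\in\mathbb{R}^{m\times p\times n}$: a factorization $\mathcal{A}=\mathcal{U}\star_{\mathbf{M}}\mathcal{S}\star_{\mathbf{M}}\mathcal{V}^{\mathsf T}$ with $\mathcal{U}\in\mathbb{R}^{m\times r\times n}$, $\mathcal{S}\in\mathbb{R}^{r\times r\times n}$, $\mathcal{V}\in\mathbb{R}^{p\times r\times n}$, obtained from matrix SVDs of the faces; i.e. for each $i$, $\hat A^{(i)}=\hat U^{(i)}\hat S^{(i)}(\hat V^{(i)})^{\mathsf T}$, where $\hat U^{(i)},\hat V^{(i)}$ have orthonormal columns (equivalently $\mathcal{U}^{\mathsf T}\star_{\mathbf{M}}\mathcal{U}$ and $\mathcal{V}^{\mathsf T}\star_{\mathbf{M}}\mathcal{V}$ are the $r\times r\times n$ identity) and $\hat S^{(i)}$ is diagonal with nonnegative, non-increasing diagonal entries. The singular tubes are $\mathbf{s}_j=\mathcal{S}_{j,j,:}$. Reflection: $R$ is the $h\times h$ row-reversal (anti-identity) matrix, and $\mathcal{R}\in\mathbb{R}^{h\times h\times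 n}$ is the tensor all of whose transform-domain faces equal $R$. $\star_{\mathbf{M}}$-symmetric: $\mathcal{A}\in\mathbb{R}^{m\times p\times n}$, $m=2h$, is $\star_{\mathbf{M}}$-symmetric if $\mathcal{A}_{1:h,:,:}=\mathcal{R}\star_{\mathbf{M}}\mathcal{A}_{h+1:m,:,:}$. *)

(* Defs.v *)
From mathcomp Require Import all_boot all_order all_algebra.
From mathcomp Require Import reals.

Set Implicit Arguments.
Unset Strict Implicit.
Unset Printing Implicit Defensive.

Import Order.TTheory GRing.Theory Num.Theory.
Local Open Scope ring_scope.

(* A third-order tensor is stored by its frontal slices: A_{i,j,k} is [A k i j].
   This makes tensors an lmodType, with entrywise addition and scaling. *)
Notation tensor R m p n := {ffun 'I_n -> 'M[R]_(m, p)}.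

Definition orthogonal_mx (R : realType) (n : nat) (W : 'M[R]_n) : Prop :=
  W^T *m W = 1%:M.

Definition tube (R : realType) (m p n : nat) (A : tensor R m p n)
  (i : 'I_m) (j : 'I_p) : 'cV[R]_n := \col_k A k i j.

Definition mode3 (R : realType) (m p n : nat) (M : 'M[R]_n)
  (A : tensor R m p n) : tensor R m p n :=
  [ffun k => \matrix_(i, j) (M *m tube A i j) k 0].

(* Transform domain: [hat M A k] is the k-th transform-domain face of A, and
   [unhat M F] is the tensor with transform-domain faces F, for invertible M
   (see [unhatK] and [hatK]). *)
Definition hat (R : realType) (m p n : nat) (M : 'M[R]_n)
  (A : tensor R m p n) : tensor R m p n := mode3 M A.

Definition unhat (R : realType) (m p n : nat) (M : 'M[R]_n)
  (F : tensor R m p n) : tensor R m p n := mode3 (invmx M) F.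

Definition tmul (R : realType) (m p l n : nat) (M : 'M[R]_n)
  (A : tensor R m p n) (B : tensor R p l n) : tensor R m l n :=
  unhat M [ffun k => hat M A k *m hat M B k].

Notation "A *t[ M ] B" := (tmul M A B)
  (at level 40, left associativity, format "A  *t[ M ]  B") : ring_scope.

Definition ttr (R : realType) (m p n : nat) (M : 'M[R]_n)
  (A : tensor R m p n) : tensor R p m n :=
  unhat M [ffun k => (hat M A k)^T].

Definition tid (R : realType) (r n : nat) (M : 'M[R]_n) : tensor R r r n :=
  unhat M [ffun=> 1%:M].

Definition rev_mx (R : realType) (h : nat) : 'M[R]_h :=
  \matrix_(i, j) (j == rev_ord i)%:R.

Definition trefl (R : realType) (h n : nat) (M : 'M[R]_n) : tensor R h h n :=
  unhat M [ffun=> rev_mx R h].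

Definition tusub (R : realType) (m1 m2 p n : nat)
  (A : tensor R (m1 + m2) p n) : tensor R m1 p n := [ffun k => usubmx (A k)].

Definition tdsub (R : realType) (m1 m2 p n : nat)
  (A : tensor R (m1 + m2) p n) : tensor R m2 p n := [ffun k => dsubmx (A k)].

Definition tstack (R : realType) (m1 m2 p n : nat)
  (A : tensor R m1 p n) (B : tensor R m2 p n) : tensor R (m1 + m2) p n :=
  [ffun k => col_mx (A k) (B k)].

Definition star_symmetric (R : realType) (h p n : nat) (M : 'M[R]_n)
  (A : tensor R (h + h) p n) : Prop :=
  tusub A = trefl h M *t[M] tdsub A.

Definition economy_svd (R : realType) (m p r : nat) (A : 'M[R]_(m, p))
  (U : 'M[R]_(m, r)) (S : 'M[R]_r) (V : 'M[R]_(p, r)) : Prop :=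
  [/\ A = U *m S *m V^T,
      U^T *m U = 1%:M /\ V^T *m V = 1%:M,
      is_diag_mx S,
      forall j : 'I_r, 0 <= S j j
    & forall j k : 'I_r, (j <= k)%N -> S k k <= S j j].

Definition economy_star_svd (R : realType) (m p r n : nat) (M : 'M[R]_n)
  (A : tensor R m p n) (U : tensor R m r n) (S : tensor R r r n)
  (V : tensor R p r n) : Prop :=
  A = U *t[M] S *t[M] ttr M V /\
  forall k : 'I_n, economy_svd (hat M A k) (hat M U k) (hat M S k) (hat M V k).

Definition fnorm (R : realType) (m p n : nat) (A : tensor R m p n) : R :=
  Num.sqrt (\sum_(i < m) \sum_(j < p) \sum_(k < n) A k i j ^+ 2).

(* S_{j,j,:} as a 1 x 1 x n tensor. *)
Definition singular_tube (R : realType) (r n : nat) (S : tensor R r r n)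
  (j : 'I_r) : tensor R 1 1 n := [ffun k => const_mx (S k j j)].

Lemma mode3_comp (R : realType) (m p n : nat) (M N : 'M[R]_n)
  (A : tensor R m p n) : mode3 M (mode3 N A) = mode3 (M *m N) A.
Proof.
apply/ffunP=> k; apply/matrixP=> i j; rewrite !ffunE [LHS]mxE [RHS]mxE.
have -> : tube (mode3 N A) i j = N *m tube A i j.
  by apply/colP=> l; rewrite mxE ffunE mxE.
by rewrite mulmxA.
Qed.

Lemma mode3_1 (R : realType) (m p n : nat) (A : tensor R m p n) :
  mode3 1%:M A = A.
Proof.
by apply/ffunP=> k; apply/matrixP=> i j; rewrite ffunE mxE mul1mx mxE.
Qed.

Lemma unhatK (R : realType) (m p n : nat) (M : 'M[R]_n) (F : tensor R m p n) :
  M \in unitmx -> hat M (unhat M F) = F.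
Proof. by move=> uM; rewrite /hat /unhat mode3_comp mulmxV // mode3_1. Qed.

Lemma hatK (R : realType) (m p n : nat) (M : 'M[R]_n) (A : tensor R m p n) :
  M \in unitmx -> unhat M (hat M A) = A.
Proof. by move=> uM; rewrite /hat /unhat mode3_comp mulVmx // mode3_1. Qed.

(* Main.v *)
(* Applying the transform M face by face turns every tensor identity into n
   independent matrix identities.  The symmetry of A gives B = X_0 and, as the
   row reversal is a symmetric involution, X_1 = R X_0; so each transformed face
   of A is [X; R X] where X = U S V^T is an SVD.  The factor 1/sqrt 2 makes the
   columns of [U; R U] orthonormal again because R^T R = 1.  The singular tubes
   are compared in the transform domain, where their entries decrease facewise:
   by Parseval, M = c W scales all Frobenius norms by |c|. *)
Require Import Defs.
From mathcomp Require Import all_boot all_order all_algebra.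
From mathcomp Require Import reals.

Set Implicit Arguments.
Unset Strict Implicit.
Unset Printing Implicit Defensive.

Import Order.TTheory GRing.Theory Num.Theory.
Local Open Scope ring_scope.

Lemma rev_mx_tr (R : realType) (h : nat) : (rev_mx R h)^T = rev_mx R h.
Proof.
by apply/matrixP=> i j; rewrite !mxE -(inv_eq (@rev_ordK h)) eq_sym.
Qed.

Lemma rev_mxK (R : realType) (h : nat) : rev_mx R h *m rev_mx R h = 1%:M.
Proof.
apply/matrixP=> i j; rewrite !mxE (bigD1 (rev_ord i)) //= !mxE eqxx mul1r.
rewrite rev_ordK big1 ?addr0 1?eq_sym // => k ki.
by rewrite !mxE (negPf ki) mul0r.
Qed.

Lemma sqrtr2_neq0 (R : realType) : Num.sqrt 2 != 0 :> R.
Proof. by rewrite sqrtr_eq0 -ltNge ltr0n. Qed.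

(** The core step on a single face. Since [rev_mx] is symmetric and squares to 1, both blocks
    contribute [U^T *m U] to the Gram matrix, and the sum 2 cancels against the square of 1/sqrt
    2. *)
Lemma economy_svd_reflect (R : realType) (h p r : nat) (X : 'M[R]_(h, p))
    (U : 'M[R]_(h, r)) (S : 'M[R]_r) (V : 'M[R]_(p, r)) :
  economy_svd X U S V ->
  economy_svd (col_mx X (rev_mx R h *m X))
    ((Num.sqrt 2)^-1 *: col_mx U (rev_mx R h *m U)) (Num.sqrt 2 *: S) V.
Proof.
case=> -> [UU VV] Sdiag S_ge0 S_decr; split=> [||||j k jk].
- rewrite -scalemxAl -scalemxAr scalerA mulVf ?sqrtr2_neq0 // scale1r.
  by rewrite !mul_col_mx !mulmxA.
- split=> //; rewrite -scalemxAr linearZ /= -scalemxAl scalerA -invfM.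
  rewrite -expr2 sqr_sqrtr ?ler0n // tr_col_mx mul_row_col trmx_mul rev_mx_tr.
  rewrite mulmxA -(mulmxA U^T) rev_mxK mulmx1 UU -mulr2n -scaler_nat scalerA.
  by rewrite mulVf ?scale1r // pnatr_eq0.
- apply/is_diag_mxP=> i j ij.
  by rewrite mxE (is_diag_mxP Sdiag) ?mulr0.
- by move=> j; rewrite mxE mulr_ge0 ?sqrtr_ge0.
- by rewrite !mxE ler_wpM2l ?sqrtr_ge0 ?S_decr.
Qed.

Section Hat.
Context (R : realType) (n : nat) (M : 'M[R]_n).

(** The sum runs over the third index only, which is why the transform commutes with scaling,
    slicing, stacking and taking a singular tube. *)
Lemma hatE (m p : nat) (A : tensor R m p n) k i j :
  hat M A k i j = \sum_l M k l * A l i j.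
Proof. by rewrite ffunE !mxE; apply: eq_bigr => l _; rewrite mxE. Qed.

Lemma hatZ (m p : nat) (a : R) (A : tensor R m p n) k :
  hat M (a *: A) k = a *: hat M A k.
Proof.
apply/matrixP=> i j; rewrite mxE !hatE mulr_sumr; apply: eq_bigr => l _.
by rewrite ffunE mxE mulrCA.
Qed.

Lemma hat_tusub (m1 m2 p : nat) (A : tensor R (m1 + m2) p n) k :
  hat M (tusub A) k = usubmx (hat M A k).
Proof.
apply/matrixP=> i j; rewrite mxE !hatE; apply: eq_bigr => l _.
by rewrite ffunE mxE.
Qed.

Lemma hat_tdsub (m1 m2 p : nat) (A : tensor R (m1 + m2) p n) k :
  hat M (tdsub A) k = dsubmx (hat M A k).
Proof.
apply/matrixP=> i j; rewrite mxE !hatE; apply: eq_bigr => l _.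
by rewrite ffunE mxE.
Qed.

Lemma tstackK_u (m1 m2 p : nat) (A : tensor R m1 p n) (B : tensor R m2 p n) :
  tusub (tstack A B) = A.
Proof. by apply/ffunP=> k; rewrite !ffunE col_mxKu. Qed.

Lemma tstackK_d (m1 m2 p : nat) (A : tensor R m1 p n) (B : tensor R m2 p n) :
  tdsub (tstack A B) = B.
Proof. by apply/ffunP=> k; rewrite !ffunE col_mxKd. Qed.

Lemma tsubK (m1 m2 p : nat) (A : tensor R (m1 + m2) p n) :
  tstack (tusub A) (tdsub A) = A.
Proof. by apply/ffunP=> k; rewrite !ffunE vsubmxK. Qed.

Lemma hat_tstack (m1 m2 p : nat) (A : tensor R m1 p n) (B : tensor R m2 p n) k :
  hat M (tstack A B) k = col_mx (hat M A k) (hat M B k).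
Proof. by rewrite -[LHS]vsubmxK -hat_tusub -hat_tdsub tstackK_u tstackK_d. Qed.

Lemma hat_singular_tube (r : nat) (S : tensor R r r n) j :
  hat M (singular_tube S j) = singular_tube (hat M S) j.
Proof.
apply/ffunP=> k; apply/matrixP=> a b; rewrite hatE ffunE mxE hatE.
by apply: eq_bigr => l _; rewrite ffunE mxE.
Qed.

Hypothesis uM : M \in unitmx.

(** Reduces tensor identities to faces. *)
Lemma hat_inj (m p : nat) (A B : tensor R m p n) :
  (forall k, hat M A k = hat M B k) -> A = B.
Proof. by move=> /ffunP AB; rewrite -(hatK A uM) AB hatK. Qed.

Lemma hat_tmul (m p l : nat) (A : tensor R m p n) (B : tensor R p l n) k :
  hat M (A *t[M] B) k = hat M A k *m hat M B k.
Proof. by rewrite unhatK // ffunE. Qed.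

Lemma hat_ttr (m p : nat) (A : tensor R m p n) k :
  hat M (ttr M A) k = (hat M A k)^T.
Proof. by rewrite unhatK // ffunE. Qed.

Lemma hat_tid (r : nat) k : hat M (tid r M) k = 1%:M.
Proof. by rewrite unhatK // ffunE. Qed.

Lemma hat_trefl (h : nat) k : hat M (trefl h M) k = rev_mx R h.
Proof. by rewrite unhatK // ffunE. Qed.

Lemma treflK (h p : nat) (A : tensor R h p n) :
  trefl h M *t[M] (trefl h M *t[M] A) = A.
Proof.
apply: hat_inj => k.
by rewrite hat_tmul hat_tmul hat_trefl mulmxA rev_mxK mul1mx.
Qed.

(** The reflection is an involution, so either half of a symmetric tensor determines the other. *)
Lemma star_symmetricP (h p : nat) (A : tensor R (h + h) p n) :
  star_symmetric M A <-> tdsub A = trefl h M *t[M] tusub A.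
Proof. by split=> [->|eqA]; rewrite ?treflK // /star_symmetric eqA treflK. Qed.

Lemma tmulZr (m p l : nat) (a : R) (A : tensor R m p n) (B : tensor R p l n) :
  A *t[M] (a *: B) = a *: (A *t[M] B).
Proof. by apply: hat_inj => k; rewrite !(hatZ, hat_tmul) scalemxAr. Qed.

Lemma economy_star_svdP (m p r : nat) (A : tensor R m p n)
    (U : tensor R m r n) (S : tensor R r r n) (V : tensor R p r n) :
  (forall k, economy_svd (hat M A k) (hat M U k) (hat M S k) (hat M V k)) ->
  economy_star_svd M A U S V.
Proof.
move=> svdA; split=> //; apply: hat_inj => k.
by rewrite hat_tmul hat_tmul hat_ttr; case: (svdA k).
Qed.

Lemma economy_star_svd_orth (m p r : nat) (A : tensor R m p n)
    (U : tensor R m r n) (S : tensor R r r n) (V : tensor R p r n) :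
  economy_star_svd M A U S V -> ttr M U *t[M] U = tid r M.
Proof.
case=> _ svdA; apply: hat_inj => k.
by rewrite hat_tmul hat_ttr hat_tid; case: (svdA k) => _ [].
Qed.

End Hat.

Lemma fnorm_ge0 (R : realType) (m p n : nat) (A : tensor R m p n) :
  0 <= fnorm A.
Proof. exact: sqrtr_ge0. Qed.

Lemma sqr_fnorm (R : realType) (m p n : nat) (A : tensor R m p n) :
  fnorm A ^+ 2 = \sum_(i < m) \sum_(j < p) \sum_(k < n) A k i j ^+ 2.
Proof. by rewrite sqr_sqrtr //; do 3!apply: sumr_ge0 => ? _; apply: sqr_ge0. Qed.

Lemma sqr_fnormZ (R : realType) (m p n : nat) (a : R) (A : tensor R m p n) :
  fnorm (a *: A) ^+ 2 = a ^+ 2 * fnorm A ^+ 2.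
Proof.
rewrite !sqr_fnorm mulr_sumr; apply: eq_bigr => i _.
rewrite mulr_sumr; apply: eq_bigr => j _.
by rewrite mulr_sumr; apply: eq_bigr => k _; rewrite ffunE mxE exprMn.
Qed.

Lemma sum_sqr_col (R : realType) (n : nat) (x : 'cV[R]_n) :
  \sum_k x k 0 ^+ 2 = (x^T *m x) 0 0.
Proof. by rewrite mxE; apply: eq_bigr => k _; rewrite mxE expr2. Qed.

(** Parseval, tube by tube: for a tube [x], the squared norm of [c *: W *m x] is c^2 x^T W^T W x. *)
Lemma sqr_fnorm_hat (R : realType) (m p n : nat) (W : 'M[R]_n) (c : R)
    (A : tensor R m p n) :
  orthogonal_mx W -> fnorm (hat (c *: W) A) ^+ 2 = c ^+ 2 * fnorm A ^+ 2.
Proof.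
move=> WW; rewrite !sqr_fnorm mulr_sumr; apply: eq_bigr => i _.
rewrite mulr_sumr; apply: eq_bigr => j _.
transitivity (\sum_k ((c *: W) *m tube A i j) k 0 ^+ 2).
  by apply: eq_bigr => k _; rewrite ffunE mxE.
transitivity (c ^+ 2 * \sum_k tube A i j k 0 ^+ 2); last first.
  by congr (_ * _); apply: eq_bigr => k _; rewrite mxE.
rewrite !sum_sqr_col -scalemxAl -scalemxAr linearZ /= -scalemxAl scalerA mxE.
by rewrite trmx_mul mulmxA -(mulmxA _ W^T) WW mulmx1.
Qed.

Lemma fnorm_singular_tube_le (R : realType) (m p r n : nat) (W : 'M[R]_n)
    (c : R) (A : tensor R m p n) (U : tensor R m r n) (S : tensor R r r n)
    (V : tensor R p r n) (j k : 'I_r) :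
  orthogonal_mx W -> c != 0 -> economy_star_svd (c *: W) A U S V ->
  (j <= k)%N -> fnorm (singular_tube S k) <= fnorm (singular_tube S j).
Proof.
move=> WW c0 [_ svdA] jk.
(* Squaring and multiplying by c^2 turns both sides into squared norms of transformed tubes, which
   are ordered entry by entry. *)
rewrite -ler_sqr ?nnegrE ?fnorm_ge0 // -(ler_pM2l (_ : 0 < c ^+ 2)); last first.
  by rewrite exprn_even_gt0.
rewrite -!(sqr_fnorm_hat _ _ WW) !hat_singular_tube !sqr_fnorm.
do 2!apply: ler_sum => ? _; apply: ler_sum => l _.
case: (svdA l) => _ _ _ S_ge0 S_decr.
rewrite (ffunE (fun=> const_mx _)) (ffunE (fun=> const_mx _)) !mxE.
by rewrite ler_sqr ?nnegrE ?S_ge0 ?S_decr.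
Qed.

Theorem theorem4p1 (R : realType) (h p r n : nat)
  (M W : 'M[R]_n) (c : R)
  (W_orth : orthogonal_mx W) (c_neq0 : c != 0) (M_eq : M = c *: W)
  (A : tensor R (h + h) p n) (A_sym : star_symmetric M A)
  (U0 : tensor R h r n) (S0 : tensor R r r n) (V0 : tensor R p r n) :
  let X0 := tusub A in
  let X1 := tdsub A in
  let B := 2^-1 *: (X0 + trefl h M *t[M] X1) in
  economy_star_svd M B U0 S0 V0 ->
  let U := (Num.sqrt 2)^-1 *: tstack U0 (trefl h M *t[M] U0) in
  let S := Num.sqrt 2 *: S0 in
  let V := V0 in
  [/\ [/\ A = U *t[M] S *t[M] ttr M V,
          economy_star_svd M A U S V
        & ttr M U *t[M] U = tid r M],
      [/\ star_symmetric M U,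
          tdsub U = trefl h M *t[M] tusub U
        & forall U' : tensor R (h + h) r n,
            star_symmetric M U' -> tusub U' = (Num.sqrt 2)^-1 *: U0 -> U' = U]
    & (forall j : 'I_r,
         fnorm (singular_tube S j) ^+ 2 = 2 * fnorm (singular_tube S0 j) ^+ 2) /\
      (forall j k : 'I_r, (j <= k)%N ->
         fnorm (singular_tube S k) <= fnorm (singular_tube S j))].
Proof.
move=> X0 X1 B svdB U S V.
have uM : M \in unitmx.
  by rewrite M_eq unitmxZ ?unitfE //; case: (mulmx1_unit W_orth).
have BE : B = X0.
  (* By symmetry the reflected lower half is [X0], so [B] averages [X0] with itself. *)
  by rewrite /B -A_sym -mulr2n -scaler_nat scalerA mulVf ?scale1r // pnatr_eq0.
have Uu : tusub U = (Num.sqrt 2)^-1 *: U0.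
  (* With [U0] written as the upper half of the stack, the claim is linearity of [usubmx]. *)
  rewrite -[U0 in RHS](tstackK_u _ (trefl h M *t[M] U0)).
  by apply/ffunP=> k; rewrite !ffunE linearZ.
have Ud : tdsub U = trefl h M *t[M] tusub U.
  rewrite Uu tmulZr // -[X in _ = _ *: X](tstackK_d U0).
  by apply/ffunP=> k; rewrite !ffunE linearZ.
have svdA : economy_star_svd M A U S V.
  apply: economy_star_svdP => // k.
  (* Rebuilding [A] from its upper half gives each face the shape required by
     [economy_svd_reflect]. *)
  rewrite -[A]tsubK ((star_symmetricP uM _).1 A_sym) !hatZ !hat_tstack.
  rewrite hat_tmul // hat_tmul // hat_trefl //; apply: economy_svd_reflect.
  by rewrite -/X0 -BE; case: svdB.
split; first by split=> //; [case: svdA | exact: economy_star_svd_orth svdA].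
  split=> //; first exact/star_symmetricP.
  move=> U' /(star_symmetricP uM) U'd U'u.
  (* [U'] and [U] share their upper half, and symmetry fixes the lower one. *)
  by rewrite -[U']tsubK U'd U'u -Uu -Ud tsubK.
have S_tube j : singular_tube S j = Num.sqrt 2 *: singular_tube S0 j.
  by apply/ffunP=> k; apply/matrixP=> a b; rewrite !(ffunE, mxE).
split=> [j|j k].
  by rewrite S_tube sqr_fnormZ sqr_sqrtr ?ler0n.
move=> jk; move: svdA; rewrite M_eq => svdA.
exact: fnorm_singular_tube_le W_orth c_neq0 svdA jk.
Qed.
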